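(* Let $W$ be the additive group of a finite field $F$, let $H$ be the multiplicative group of $F$, acting on $W$ by scalar multiplication, and consider the wreath product $X=H\wr S_2$ in its imprimitive action on $V=W^2$. Let $G$ be a subgroup of $X$ satisfying the following conditions: (1) $\langle (1,2),\ (h,h^{-1})\mid h\in H\rangle\subseteq G$; (2) $(k,1)\in G$ for some $1\ne k\in H$. Then $G$ is an irreducible IBIS subgroup of $\mathrm{GL}(V)$, with $b(G)=2$. In particular, if $H$ is a 2-group, then $G$ is a nilpotent irreducible IBIS linear group.
   Context: $V=W^2$ is regarded as a vector space over the prime field of $F$. Elements $(h_1,h_2)$ of the base group $H\times H$ of $X$ act by $(w_1,w_2)\mapsto(h_1w_1,h_2w_2)$, and $(1,2)\in S_2$ denotes the transposition, acting by $(w_1,w_2)\mapsto(w_2,w_1)$. For a finite permutation group $G$ on $\Omega$, a sequence $(\omega_1,\dots,\omega_t)$ is an irredundant base if its pointwise stabilizer is trivial and no $\omega_i$ is fixed by the pointwise stabilizer of its predecessors. $G$ is IBIS if all its irredundant bases have the same cardinality. A subgroup of $\mathrm{GL}(V)$ is called IBIS if it induces an IBIS permutation group on $V\setminus\{0\}$. $b(G)$ denotes the smallest cardinality of a base (subset with trivial pointwise stabilizer) for the action of $G$ on $V\setminus\{0\}$. *)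

(* Defs.v *)
From HB Require Import structures.
From mathcomp Require Import all_boot all_fingroup all_algebra all_solvable.
From mathcomp Require Import all_field.

Set Implicit Arguments.
Unset Strict Implicit.
Unset Printing Implicit Defensive.

Import GroupScope GRing.Theory.

Section Bases.

Variables (aT : finGroupType) (D : {group aT}) (T : finType).
Variables (to : action D T) (A : {set aT}) (S : {set T}).

Definition is_base (B : {set T}) : bool :=
  (B \subset S) && ('C_A(B | to) == 1).

Definition irredundant_base (s : seq T) : bool :=
  is_base [set:: s] &&
  [forall i : 'I_(size s),
     tnth (in_tuple s) i \notin 'Fix_to('C_A([set:: take i s] | to))].

(* Faithfulness on S identifies A with the permutation group it induces on S,
   so that stabilizers can be computed in A. *)
Definition IBIS : Prop :=
  [/\ [acts A, on S | to], [faithful A, on S | to]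
    & forall s t : seq T,
        irredundant_base s -> irredundant_base t -> size s = size t].

(* If A is faithful on S then S itself is a base, so the minimum is over a
   nonempty family; otherwise there is no base and the value is meaningless. *)
Definition base_size : nat := #|[arg min_(B < S | is_base B) #|B|]|.

End Bases.

Section Wreath.

Variable gT : finGroupType.

(* A permutation of two points is odd exactly when it is the transposition. *)
Definition permute_pair (T : Type) (x : T * T) (s : 'S_2) : T * T :=
  if odd_perm s then (x.2, x.1) else x.

Lemma permute_pair1 (T : Type) (x : T * T) : permute_pair x 1 = x.
Proof. by rewrite /permute_pair odd_perm1. Qed.

Lemma permute_pairM (T : Type) (x : T * T) (s t : 'S_2) :
  permute_pair x (s * t) = permute_pair (permute_pair x s) t.
Proof.
by case: x => a b; rewrite /permute_pair odd_permM; do 2!case: odd_perm.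
Qed.

Definition swap_action := TotalAction (@permute_pair1 gT) (@permute_pairM gT).

Lemma swap_is_groupAction :
  is_groupAction [set: gT * gT] swap_action.
Proof.
move=> s _; rewrite /Aut inE; apply/andP; split.
  by apply/subsetP=> x _; rewrite inE.
apply/morphicP=> x y _ _; rewrite !actpermE /= /permute_pair.
by case: odd_perm.
Qed.

Definition swap_groupAction := GroupAction swap_is_groupAction.

Definition wreath2 : finGroupType := sdprod_groupType swap_groupAction.

Definition wr_base (h : gT * gT) : wreath2 := sdpair1 swap_groupAction h.
Definition wr_top (s : 'S_2) : wreath2 := sdpair2 swap_groupAction s.

Definition wr_swap : wreath2 := wr_top (tperm ord0 ord_max).

End Wreath.

Section Imprimitive.

Variables (F : finFieldType) (p : nat) (charFp : p \in [pchar F]%R).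

Local Notation W := (pPrimeCharType charFp).

(* pPrimeCharType carries the structure of F as a vector space over its prime
   field 'F_p. *)
Definition planeV : Type := (W * W)%type.
HB.instance Definition _ := Vector.on planeV.
HB.instance Definition _ := Finite.on planeV.

Definition base_act (w : planeV) (h : {unit F} * {unit F}) : planeV :=
  ((val h.1 * (w.1 : F))%R, (val h.2 * (w.2 : F))%R).

(* By the convention of sdprod_by, the pair (s, h) is the product
   wr_top s * wr_base h, and actions are on the right: s acts first. *)
Definition impr_fun (w : planeV) (x : wreath2 {unit F}) : planeV :=
  base_act (permute_pair w (pair_of_sd x).1) (pair_of_sd x).2.

Lemma impr_fun1 w : impr_fun w 1 = w.
Proof.
case: w => a b; rewrite /impr_fun /base_act /= permute_pair1 /=.
by rewrite !mul1r.
Qed.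

Lemma base_actM w h k : base_act w (h * k) = base_act (base_act w h) k.
Proof.
case: w h k => a b [h1 h2] [k1 k2]; rewrite /base_act /=.
by congr (_, _); rewrite mulrA; congr (_ * _)%R; apply: mulrC.
Qed.

Lemma base_act_swap w h (s : 'S_2) :
  permute_pair (base_act w h) s = base_act (permute_pair w s) (permute_pair h s).
Proof. by rewrite /permute_pair; case: odd_perm. Qed.

Lemma impr_funM w x y : impr_fun w (x * y) = impr_fun (impr_fun w x) y.
Proof.
case: x y => [[s h] hx] [[t k] hy]; rewrite /impr_fun [pair_of_sd _]/=.
by rewrite permute_pairM base_actM base_act_swap.
Qed.

Definition impr_action : {action wreath2 {unit F} &-> planeV} :=
  TotalAction impr_fun1 impr_funM.

Lemma impr_action_base (w1 w2 : W) (h1 h2 : {unit F}) :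
  impr_action (w1, w2) (wr_base (h1, h2)) =
  ((val h1 * (w1 : F))%R, (val h2 * (w2 : F))%R).
Proof.
rewrite /= /impr_fun /wr_base /sdpair1 val_insubd inE !inE /=.
by rewrite permute_pair1.
Qed.

Lemma impr_action_swap (w1 w2 : W) :
  impr_action (w1, w2) (wr_swap {unit F}) = (w2, w1).
Proof.
rewrite /= /impr_fun /wr_swap /wr_top /sdpair2 val_insubd inE !inE /=.
by rewrite /permute_pair odd_tperm /base_act /= !mul1r.
Qed.

Definition GLset : {set {perm planeV}} :=
  [set s : {perm planeV} |
     [forall a : 'F_p, forall u : planeV, forall v : planeV,
        s (a *: u + v)%R == (a *: s u + s v)%R]].

Lemma GLP (s : {perm planeV}) : reflect (linear s) (s \in GLset).
Proof.
rewrite inE; apply: (iffP forallP) => [H a u v | H a].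
  by apply/eqP; move/forallP: (H a) => /(_ u) /forallP /(_ v).
by apply/forallP=> u; apply/forallP=> v; rewrite H.
Qed.

Lemma GL_group_set : group_set GLset.
Proof.
apply/group_setP; split; first by apply/GLP=> a u v; rewrite !perm1.
by move=> s t /GLP hs /GLP ht; apply/GLP=> a u v; rewrite !permM hs ht.
Qed.

Definition GL : {group {perm planeV}} := Group GL_group_set.

Definition nonzeroV : {set planeV} := [set v | v != 0%R].

(* G acts as a subgroup of GL(V). *)
Definition linear_group (G : {set wreath2 {unit F}}) : Prop :=
  [faithful G, on [set: planeV] | impr_action] /\
  actperm impr_action @* G \subset GL.

Definition irreducible_group (G : {set wreath2 {unit F}}) : Prop :=
  ({: planeV} != 0)%VS /\
  forall U : {vspace planeV},
    (forall g u, g \in G -> u \in U -> impr_action u g \in U) ->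
    U = 0%VS \/ U = fullv.

Definition IBIS_linear (G : {set wreath2 {unit F}}) : Prop :=
  IBIS impr_action G nonzeroV.

End Imprimitive.

(* Main.v *)
Require Import Defs.
From mathcomp Require Import all_boot all_fingroup all_algebra all_solvable.
From mathcomp Require Import all_field.

Import GroupScope GRing.Theory.

(** The action of X on the nonzero vectors of V is so close to free that every
    pointwise stabilizer can be written down. The stabilizer of a vector on a
    coordinate axis, say (a, 0), consists of elements (1, h), and (1, h) moves
    every vector off that axis unless h = 1; the stabilizer of a vector (a, b)
    off both axes contains a single nontrivial element, the transposition
    twisted by (a / b, b / a). In both cases, as soon as the stabilizer of v
    moves u, the common stabilizer of v and u is trivial
    ([fixed_point_pair], [stab_pair_eq1]). This holds in X and is inherited by
    every subgroup.

    What depends on G is that one vector is never enough: G contains the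
    twisted transpositions and, for some k <> 1, both (k, 1) and
    (1, k) = (k, 1) (k^-1, k), so no nonzero vector has trivial stabilizer
    ([stabilizer_neq1]). An irredundant base must then have at least two points,
    and its second point already kills the stabilizer, so it has exactly two;
    this part is valid for any faithful action with these two properties
    ([size_irredundant_base], [base_size_eq2]).

    For irreducibility, a nonzero invariant subspace contains a vector whose
    first coordinate is nonzero, thanks to the transposition; (k, 1) - 1 sends
    it to a nonzero vector of the first axis, the elements (h, h^-1) are
    transitive on the nonzero vectors of that axis, and the transposition
    carries the axis to the other one.
    Finally, if H is a 2-group then so is X, hence G is nilpotent. *)

(** * Actions whose irredundant bases all have two points *)

Section UniformBases.

Variables (aT : finGroupType) (D : {group aT}) (T : finType).
Variables (to : action D T) (A : {group aT}) (S : {set T}).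

Hypothesis S_neq0 : S != set0.
Hypothesis stab_neq1 : forall v, v \in S -> 'C_A[v | to] != 1.

Lemma base_card_gt1 (B : {set T}) : is_base to A S B -> 1 < #|B|.
Proof.
case/andP=> sBS /eqP cB1; rewrite ltnNge; apply/negP=> /card_le1_eqP B_le1.
have [v Sv sBv] : exists2 v, v \in S & B \subset [set v].
  have [B0|[v Bv]] := set_0Vmem B.
    by have [v Sv] := set0Pn _ S_neq0; exists v; rewrite ?B0 ?sub0set.
  exists v; first exact: subsetP sBS v Bv.
  by apply/subsetP=> u Bu; rewrite inE (B_le1 u v Bu Bv).
case/negP: (stab_neq1 v Sv); rewrite -subG1 -cB1 setIS //.
exact: astabS.
Qed.

Hypothesis stab2_eq1 : forall v u, v \in S ->
  u \notin 'Fix_to('C_A[v | to]) -> 'C_A([set v; u] | to) = 1.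

(** A third point would have to be moved by the trivial group. *)
Lemma size_irredundant_base s : irredundant_base to A S s -> size s = 2.
Proof.
case/andP=> Bs /forallP irr; apply/eqP; rewrite eqn_leq; apply/andP; split.
  case: s Bs irr => [|v [|u [|w s]]] // /andP[/subsetP sS _] irr.
  have Sv : v \in S by apply: sS; rewrite !inE eqxx.
  have set_seq1 : [set:: [:: v]] = [set v] by apply/setP=> x; rewrite !inE.
  have set_seq2 : [set:: [:: v; u]] = [set v; u].
    by apply/setP=> x; rewrite !inE.
  have := irr (@Ordinal (size [:: v, u, w & s]) 1 isT).
  rewrite (tnth_nth v) /= set_seq1 => /(stab2_eq1 v u Sv) c1.
  have := irr (@Ordinal (size [:: v, u, w & s]) 2 isT).
  by rewrite (tnth_nth v) /= set_seq2 c1 afix1 inE.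
apply: leq_trans (base_card_gt1 _ Bs) _.
by rewrite cardsE card_size.
Qed.

(** Faithfulness turns a nontrivial element of a point stabilizer into a
    second point completing that point to a base. *)
Lemma base_size_eq2 : [faithful A, on S | to] -> base_size to A S = 2.
Proof.
move=> ffS; rewrite /base_size.
have BS : is_base to A S S by rewrite /is_base subxx -subG1.
case: arg_minnP => // B BB minB; apply/eqP.
rewrite eqn_leq base_card_gt1 // andbT.
have [v Sv] := set0Pn _ S_neq0.
have [z Cz z_neq1] : exists2 z, z \in 'C_A[v | to] & z != 1.
  by apply/trivgPn; apply: stab_neq1.
have [u Su zu] : exists2 u, u \in S & to u z != u.
  apply/exists_inP; apply: contraNT z_neq1; rewrite negb_exists_in.
  move/forall_inP=> fixS; have /setIP[Az /setIP[Dz _]] := Cz.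
  rewrite -in_set1 (subsetP ffS) // !inE Az Dz /=.
  by apply/subsetP=> u Su; rewrite inE -[_ == _]negbK fixS.
apply: leq_trans (minB [set v; u] _) _; last by rewrite cards2; case: (v != u).
rewrite /is_base stab2_eq1 // ?eqxx ?andbT.
  by apply/subsetP=> x /set2P[]->.
by apply: contra zu => /afixP fixu; apply/eqP/fixu.
Qed.

End UniformBases.

(** * The wreath product of a group with the symmetric group of degree 2 *)

Section Wreath.

Variable gT : finGroupType.

Lemma wreath2P (g : wreath2 gT) :
  exists h1 h2, g = wr_base (h1, h2) \/ g = wr_swap gT * wr_base (h1, h2).
Proof.
have S2E : [set: 'S_2] = [set 1; tperm ord0 ord_max].
  apply/esym/eqP; rewrite eqEcard subsetT cardsT card_Sn cards2.
  by case: eqP => // /(congr1 (@odd_perm _)); rewrite odd_perm1 odd_tperm.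
exists g.2.1, g.2.2; rewrite -surjective_pairing /wr_base.
have := sdpairE g; have /set2P[->|->] : g.1 \in [set 1; tperm ord0 ord_max].
- by rewrite -S2E inE.
- by rewrite (morph1 (sdpair2_morphism (swap_groupAction gT))) mul1g; left.
- by right.
Qed.

Lemma wr_baseM (x y : gT * gT) : wr_base (x * y) = wr_base x * wr_base y.
Proof. exact: (morphM (sdpair1_morphism (swap_groupAction gT))). Qed.

Lemma wr_base_inj : injective (@wr_base gT).
Proof.
by move=> x y; apply: (injmP (injm_sdpair1 (swap_groupAction gT))); rewrite inE.
Qed.

Lemma wr_base1 : @wr_base gT 1 = 1.
Proof. exact: (morph1 (sdpair1_morphism (swap_groupAction gT))). Qed.

Lemma pgroup_wreath2 (pi : nat_pred) : 2%N \in pi ->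
  pi.-group [set: gT] -> pi.-group [set: wreath2 gT].
Proof.
move=> pi2 pi_gT.
rewrite /pgroup -(sdprod_card (sdprod_sdpair (swap_groupAction gT))).
rewrite pnatM; apply/andP; split; apply: morphim_pgroup.
  by rewrite /pgroup cardsT card_prod pnatM -!cardsT; apply/andP.
by rewrite /pgroup cardsT card_Sn pnatE.
Qed.

End Wreath.

(** * The imprimitive action on the plane *)

Section Plane.

Variables (F : finFieldType) (p : nat) (charFp : p \in [pchar F]%R).
Notation X := (wreath2 {unit F}).
Notation W := (pPrimeCharType charFp).
Notation V := (planeV charFp).
Notation to := (impr_action charFp).
Implicit Types (a b : F) (v u : V) (g x z : X) (h k : {unit F}).

Lemma unit_of a : a != 0%R -> exists h, val h = a.
Proof. by rewrite -unitfE => Ua; exists (FinRing.Unit Ua). Qed.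

Lemma unit_mulI h k a : a != 0%R -> (val h * a = val k * a)%R -> h = k.
Proof. by move=> a0 /(mulIf a0)/val_inj. Qed.

Lemma unit_mul_fix h a : a != 0%R -> (val h * a = a)%R -> h = 1.
Proof. by move=> a0 eq_a; apply: (unit_mulI _ _ a) => //; rewrite mul1r. Qed.

Lemma unit_mul_neq0 h a : (val h * a != 0)%R = (a != 0%R).
Proof. by rewrite mulf_eq0 negb_or -unitfE (valP h). Qed.

Lemma impr_action_swap_base (a b : W) h1 h2 :
  to (a, b) (wr_swap {unit F} * wr_base (h1, h2))
  = ((val h1 * (b : F))%R, (val h2 * (a : F))%R).
Proof. by rewrite actM impr_action_swap impr_action_base. Qed.

Lemma impr_action_linear g : linear (to^~ g).
Proof.
have mulW (h a a' : W) (c : 'F_p) :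
    (h * (c *: a + a') = c *: (h * a) + h * a')%R.
  by rewrite mulrDr scalerAr.
have [h1 [h2 [] ->]] := wreath2P _ g; move=> c [a b] [a' b'];
rewrite -[(c *: (a, b) + _)%R]/((c *: a + a')%R, (c *: b + b')%R);
by rewrite ?impr_action_base ?impr_action_swap_base;
   congr (_, _); apply: mulW.
Qed.

Lemma nonzeroVE (a b : W) :
  ((a, b) \in nonzeroV charFp) = ((a : F) != 0%R) || ((b : F) != 0%R).
Proof. by rewrite inE -negb_and. Qed.

(** Elements outside the base group fix no nonzero vector on an axis; the
    hypothesis is the first coordinate of the fixed point equation. *)
Lemma swap_fix_neq0 a b h :
  (a != 0%R) || (b != 0%R) -> (val h * b = a)%R -> a != 0%R /\ b != 0%R.
Proof.
by move=> ab0 eq_a; move: ab0; rewrite -eq_a unit_mul_neq0 orbb => b0.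
Qed.

(** Call an element diagonal if it lies in the base group and odd otherwise.
    Two diagonal elements fixing v are both 1 at a nonzero coordinate of v; as
    z moves u, the other coordinate of u is nonzero, which forces x to be 1
    there too. An odd element can only fix v off both axes. There a diagonal
    element fixing v is trivial, which settles the mixed cases, and an odd one
    is determined by v, so that x and z cannot both be odd. *)
Lemma fixed_point_pair v u x z : v \in nonzeroV charFp ->
  to v x = v -> to v z = v -> to u z != u -> to u x = u -> x = 1.
Proof.
case: v u => a b [c d]; rewrite nonzeroVE => v0.
have [h1 [h2 [] ->]] := wreath2P _ x; have [k1 [k2 [] ->]] := wreath2P _ z;
rewrite ?impr_action_base ?impr_action_swap_base => -[xa xb] [za zb] zu [xc xd].
- suff [-> ->] : h1 = 1 /\ h2 = 1 by rewrite wr_base1.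
  case/orP: v0 => [a0|b0].
    rewrite (unit_mul_fix _ _ a0 xa); split=> //.
    apply: (unit_mul_fix _ d) => //; apply: contraNneq zu => d0.
    by rewrite (unit_mul_fix _ _ a0 za) d0 mul1r mulr0.
  rewrite (unit_mul_fix _ _ b0 xb); split=> //.
  apply: (unit_mul_fix _ c) => //; apply: contraNneq zu => c0.
  by rewrite (unit_mul_fix _ _ b0 zb) c0 mul1r mulr0.
- have [a0 b0] := swap_fix_neq0 _ _ _ v0 za.
  by rewrite (unit_mul_fix _ _ a0 xa) (unit_mul_fix _ _ b0 xb) wr_base1.
- have [a0 b0] := swap_fix_neq0 _ _ _ v0 xa.
  rewrite (unit_mul_fix _ _ a0 za) (unit_mul_fix _ _ b0 zb) in zu.
  by rewrite !mul1r eqxx in zu.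
- have [a0 b0] := swap_fix_neq0 _ _ _ v0 xa.
  have e1 : h1 = k1 by apply: (unit_mulI _ _ _ b0); rewrite xa za.
  have e2 : h2 = k2 by apply: (unit_mulI _ _ _ a0); rewrite xb zb.
  by rewrite -e1 -e2 xc xd eqxx in zu.
Qed.

Lemma stab_pair_eq1 (G : {group X}) v u : v \in nonzeroV charFp ->
  u \notin 'Fix_to('C_G[v | to]) -> 'C_G([set v; u] | to) = 1.
Proof.
move=> v0 /afixP fixu; apply/trivgP/subsetP=> x /setIP[Gx /astabP fixx].
apply/set1P/eqP; apply: contra_notT fixu => x_neq1 z /setIP[Gz /astab1P fixz].
apply/eqP; apply: contraNT x_neq1 => zu.
by apply/eqP/(fixed_point_pair v u x z) => //; apply: fixx;
  rewrite !inE eqxx ?orbT.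
Qed.

Lemma wreath2_faithful : [faithful [set: X], on nonzeroV charFp | to].
Proof.
apply/subsetP=> x /setIP[_ /astabP fix_x]; apply/set1P.
have := fix_x ((0, 1)%R : V); have := fix_x ((1, 0)%R : V).
rewrite !nonzeroVE oner_eq0 orbT => /(_ isT) x1 /(_ isT) x2; move: x1 x2.
have [h1 [h2 [] ->]] := wreath2P _ x;
rewrite ?impr_action_base ?impr_action_swap_base.
  move=> -[e1 _] [_ e2].
  rewrite (unit_mul_fix _ _ (oner_neq0 F) e1).
  by rewrite (unit_mul_fix _ _ (oner_neq0 F) e2) wr_base1.
by case=> /eqP; rewrite mulr0 eq_sym oner_eq0.
Qed.

Lemma faithfulS (A B : {set X}) (S1 S2 : {set V}) :
  A \subset B -> S1 \subset S2 ->
  [faithful B, on S1 | to] -> [faithful A, on S2 | to].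
Proof. by move=> sAB sS; apply/subset_trans/setISS/astabS. Qed.

Lemma acts_nonzeroV : [acts [set: X], on nonzeroV charFp | to].
Proof.
apply/subsetP=> x _; apply/astabsP=> v; rewrite !inE; congr (~~ _).
have x0 : to 0%R x = 0%R.
  have := impr_action_linear x (-1)%R 0%R 0%R.
  by rewrite !scaleN1r !addNr.
by rewrite -[in LHS]x0 (inj_eq (act_inj to x)).
Qed.

Lemma linear_wreath2 (G : {set X}) : linear_group charFp G.
Proof.
split.
  by apply: faithfulS wreath2_faithful; rewrite subsetT.
apply/subsetP=> _ /morphimP[x _ _ ->]; apply/GLP=> c u v.
by rewrite !actpermE impr_action_linear.
Qed.

End Plane.

(** * Subgroups containing the transposition, all (h, h^-1) and some (k, 1) *)

Section Main.

Variables (F : finFieldType) (p : nat) (charFp : p \in [pchar F]%R).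
Variable (G : {group wreath2 {unit F}}).
Notation V := (planeV charFp).
Notation to := (impr_action charFp).
Implicit Types (h : {unit F}).

Hypothesis G_swap : wr_swap {unit F} \in G.
Hypothesis G_inv : forall h, wr_base (h, h^-1) \in G.
Variable (k : {unit F}).
Hypothesis k_neq1 : k != 1.
Hypothesis G_k : wr_base (k, 1) \in G.

Lemma wr_base1r : wr_base (1, k) \in G.
Proof.
have -> : (1, k) = (k, 1) * (k^-1, k^-1^-1) :> {unit F} * {unit F}.
  by congr (_, _); rewrite /= ?mulgV ?invgK ?mul1g.
by rewrite wr_baseM groupM.
Qed.

Lemma stabilizer_neq1 v : v \in nonzeroV charFp -> 'C_G[v | to] != 1.
Proof.
case: v => a b; rewrite nonzeroVE => v0; apply/trivgPn.
have [->|b0] := eqVneq (b : F) 0%R.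
  exists (wr_base (1, k)).
    apply/setIP; split; first exact: wr_base1r.
    by apply/astab1P; rewrite impr_action_base mul1r mulr0.
  by rewrite -wr_base1 (inj_eq (@wr_base_inj _)) xpair_eqE (negPf k_neq1) andbF.
have [->|a0] := eqVneq (a : F) 0%R.
  exists (wr_base (k, 1)).
    apply/setIP; split; first exact: G_k.
    by apply/astab1P; rewrite impr_action_base mul1r mulr0.
  by rewrite -wr_base1 (inj_eq (@wr_base_inj _)) xpair_eqE (negPf k_neq1).
(* the unique h for which the transposition followed by (h, h^-1) fixes v *)
have [h hE] := unit_of F (a / b)%R (mulf_neq0 a0 (invr_neq0 b0)).
exists (wr_swap {unit F} * wr_base (h, h^-1)).
  apply/setIP; split; first by rewrite groupM.
  apply/astab1P; rewrite impr_action_swap_base FinRing.val_unitV hE.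
  by rewrite divfK // invf_div divfK.
apply/eqP=> /(congr1 (to ((1, 0)%R : V))).
rewrite impr_action_swap_base act1 => -[/eqP].
by rewrite mulr0 eq_sym oner_eq0.
Qed.

Lemma irreducible_of_swap_inv : irreducible_group charFp G.
Proof.
split.
  apply/eqP=> V0; have: ((1, 0)%R : V) \in fullv by exact: memvf.
  by rewrite V0 memv0 -[_ == _]/((1 == 0 :> F)%R && _) oner_eq0.
move=> U UG; have [U0|[u Uu u0]] : U = 0%VS \/ exists2 u, u \in U & u != 0%R.
- have [->|] := eqVneq U 0%VS; first by left.
  by rewrite -vpick0 => U0; right; exists (vpick U); first exact: memv_pick.
- by left.
right.
(* after a swap if necessary, the first coordinate is nonzero *)
have [a [b [a0 Uab]]] : exists a b : F, a != 0%R /\ ((a, b) : V) \in U.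
  case: u Uu u0 => a b Uu u0.
  have [a0|a0] := eqVneq (a : F) 0%R; last by exists a, b.
  exists b, a; split; first by apply: contraNneq u0 => ->; rewrite a0.
  by rewrite -impr_action_swap; apply: UG.
(* subtracting a vector from its image by (k, 1) kills the second coordinate *)
have [c c0 Uc] : exists2 c : F, c != 0%R & ((c, 0)%R : V) \in U.
  exists (val k * a - a)%R.
    rewrite subr_eq0; apply: contra k_neq1 => /eqP eq_a.
    by apply/eqP; exact: unit_mul_fix a0 eq_a.
  have := memvB (UG _ _ G_k Uab) Uab; rewrite impr_action_base.
  rewrite -[(_ - _)%R]/((val k * a - a)%R, (val (1%g : {unit F}) * b - b)%R).
  by rewrite mul1r subrr.
(* the (h, h^-1) move that vector all along the first axis *)
have Ul (d : F) : ((d, 0)%R : V) \in U.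
  have [->|d0] := eqVneq d 0%R; first exact: mem0v.
  have [h hE] := unit_of F (d / c)%R (mulf_neq0 d0 (invr_neq0 c0)).
  have := UG _ _ (G_inv h) Uc.
  by rewrite impr_action_base mulr0 hE divfK.
apply/vspaceP=> -[d e]; rewrite memvf.
have := memvD (Ul d) (UG _ _ G_swap (Ul e)); rewrite impr_action_swap.
rewrite -[(_ + _)%R]/((d + 0)%R, (0 + e)%R).
by rewrite addr0 add0r.
Qed.

End Main.

Theorem proposition1p7 (F : finFieldType) (p : nat) (charFp : p \in [pchar F]%R)
    (G : {group wreath2 {unit F}})
    (hG1 : <<wr_swap {unit F} |: [set wr_base (h, h^-1) | h : {unit F}]>>
             \subset G)
    (hG2 : exists2 k : {unit F}, k != 1 & wr_base (k, 1) \in G) :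
  [/\ linear_group charFp G,
      irreducible_group charFp G,
      IBIS_linear charFp G
    & base_size (impr_action charFp) G (nonzeroV charFp) = 2%N]
  /\ (2%N.-group [set: {unit F}] ->
      [/\ nilpotent G, linear_group charFp G, irreducible_group charFp G
        & IBIS_linear charFp G]).
Proof.
have G_gen g :
    g \in wr_swap {unit F} |: [set wr_base (h, h^-1) | h : {unit F}] -> g \in G.
  by move=> Ag; apply: (subsetP hG1); apply: mem_gen.
have G_swap : wr_swap {unit F} \in G by apply: G_gen; apply: setU11.
have G_inv h : wr_base (h, h^-1) \in G.
  by apply: G_gen; apply/setU1r/imset_f.
have [k k_neq1 G_k] := hG2.
have linG := linear_wreath2 F p charFp G.
have irrG := irreducible_of_swap_inv F p charFp G G_swap G_inv k k_neq1 G_k.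
have ffG : [faithful G, on nonzeroV charFp | impr_action charFp].
  by apply: faithfulS (wreath2_faithful F p charFp); rewrite ?subsetT.
have V_neq0 : nonzeroV charFp != set0.
  apply/set0Pn; exists ((1, 0)%R : planeV charFp).
  by rewrite nonzeroVE oner_eq0.
have stab1 := stabilizer_neq1 F p charFp G G_swap G_inv k k_neq1 G_k.
have stab2 v u := stab_pair_eq1 F p charFp G v u.
have ibisG : IBIS_linear charFp G.
  split=> // [|s t /size_irredundant_base sz_s /size_irredundant_base sz_t].
    exact: subset_trans (subsetT _) (acts_nonzeroV F p charFp).
  by rewrite sz_s ?sz_t.
split; first by split=> //; apply: base_size_eq2.
move=> pH; split=> //; apply: (@pgroup_nil _ 2).
apply: pgroupS (subsetT _) _.
exact: (pgroup_wreath2 {unit F} 2%N isT pH).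
Qed.
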